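(* Let $\mathbb{F}$ be a field with $|\mathbb{F}|\geq 3$, let $A\in M_n(\mathbb{F})$, let $\mathcal{B}$ be a linear subspace of $M_n(\mathbb{F})$ contained in $W_n(\mathbb{F})$, and let $\mathcal{S}=A+\mathcal{B}$. If $\rho(\mathcal{S})=k$ then $\dim\mathcal{S}\le u_s(n,k)$, where $u_s(n,k)=\max\{\binom{2t+1}{2},\, tn-\binom{t}{2}\}$ if $k=2t$, and $u_s(n,k)=\max\{\binom{2t+2}{2},\, tn-\binom{t}{2}+1\}$ if $k=2t+1$.
   Context: $M_n(\mathbb{F})$ is the space of $n\times n$ matrices over $\mathbb{F}$. A matrix $A=(A(i,j))$ is weakly symmetric if for all $i,j$: $A(i,j)\neq0$ iff $A(j,i)\neq 0$; $W_n(\mathbb{F})$ is the set of weakly symmetric matrices in $M_n(\mathbb{F})$. For a set $\mathcal{S}$ of matrices, $\rho(\mathcal{S})=\max\{\mathrm{rk}(A):A\in\mathcal{S}\}$. The dimension of $\mathcal{S}=A+\mathcal{B}$ is $\dim\mathcal{B}$. *)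

(* Defs.v *)
From HB Require Import structures.
From mathcomp Require Import all_boot all_order all_algebra.
Set Implicit Arguments.
Unset Strict Implicit.
Unset Printing Implicit Defensive.
Import GRing.Theory.
Local Open Scope ring_scope.

Definition weakly_symmetric (F : fieldType) (n : nat) (A : 'M[F]_n) : Prop :=
  forall i j : 'I_n, A i j != 0 <-> A j i != 0.

(* The affine space A + B; its dimension is by definition \dim B. *)
Definition affine_space (F : fieldType) (n : nat) (A : 'M[F]_n)
    (B : {vspace 'M[F]_n}) (M : 'M[F]_n) : Prop :=
  exists2 X : 'M[F]_n, X \in B & M = A + X.

(* rho(S) = k: the maximum is stated relationally, as attained upper bound. *)
Definition max_rank_eq (F : fieldType) (n : nat) (S : 'M[F]_n -> Prop)
    (k : nat) : Prop :=
  (exists2 M : 'M[F]_n, S M & \rank M = k) /\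
  (forall M : 'M[F]_n, S M -> (\rank M <= k)%N).

(* The natural subtraction t * n - 'C(t, 2) does not truncate when t <= n,
   hence in particular whenever k is a rank of an n x n matrix. *)
Definition u_s (n k : nat) : nat :=
  (let t := k./2 in
   if odd k then maxn 'C(2 * t + 2, 2) (t * n - 'C(t, 2) + 1)
   else maxn 'C(2 * t + 1, 2) (t * n - 'C(t, 2)))%N.

(* Main.v *)
(** Order the positions [{i, j}] linearly by the weights [3 ^ i + 3 ^ j] and let [P]
    be the set of leading (heaviest nonzero) positions of the nonzero matrices of
    [B], so that [\dim B <= #|P|].  View [P] as a graph with loops.  If disjoint
    edges and loops of [P] cover [c] vertices, take the members [X_l] of [B] that they
    lead and look at the corresponding [c x c] minor of [A + \sum_l x_l X_l]: since
    the weights add up, the coefficient of the monomial in which edges have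
    exponent 2 and loops exponent 1 is the product of the leading entries, up to
    sign.  It is a coefficient of top degree, so three points in each variable
    suffice to find a nonzero value, whence [c <= k].

    It remains to bound the number of edges of a graph with loops whose matchings
    cover at most [k] vertices.  If deleting some vertex decreases this maximum by 2,
    delete it and induct.  Otherwise, by an alternating path argument, there are at
    most ['C(k + 1, 2)] edges.  With [a] deletions this gives the bound
    [a n - 'C(a, 2) + 'C(k + 1 - 2 a, 2)], which is convex in [a]. *)

Require Import Defs.
From HB Require Import structures.
From mathcomp Require Import all_boot all_order all_algebra.
From mathcomp Require Import fingroup perm ring zify.
Set Implicit Arguments.
Unset Strict Implicit.
Unset Printing Implicit Defensive.
Import GRing.Theory.

(** * Matchings and edge counts in graphs with loops *)

Section Matchings.
Variables (T : finType) (e : rel T).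
Hypothesis e_sym : symmetric e.

(** A matching is encoded as an involution: a fixed point in [C] stands for a loop, one outside [C]
    for an uncovered vertex. *)
Definition is_matching (m : {ffun T -> T}) (C : {set T}) : bool :=
  [forall x, (m (m x) == x) && (if x \in C then e x (m x) else m x == x)].

Definition matchable (C : {set T}) : bool := [exists m, is_matching m C].

Definition edges : {set {set T}} :=
  [set p | [exists x, exists y, (p == [set x; y]) && e x y]].

Lemma is_matchingP (m : {ffun T -> T}) (C : {set T}) :
  reflect [/\ involutive m, {in C, forall x, e x (m x)}
            & forall x, x \notin C -> m x = x] (is_matching m C).
Proof.
apply: (iffP forallP) => [mP | [mm mC mN] x].
  split=> [x|x xC|x xC]; have /andP[/eqP //] := mP x.
    by rewrite xC.
  by rewrite (negPf xC) => _ /eqP.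
by rewrite mm eqxx /=; case: ifP => [|/negbT] xC; [apply: mC | rewrite mN].
Qed.

Lemma matchable0 : matchable set0.
Proof.
apply/existsP; exists [ffun x => x]; apply/is_matchingP.
by split=> [x|x|x]; rewrite ?inE // !ffunE.
Qed.

Lemma matching_mem (m : {ffun T -> T}) (C : {set T}) x :
  is_matching m C -> (m x \in C) = (x \in C).
Proof.
case/is_matchingP => mm mC mN; apply/idP/idP => [mxC|xC].
  by apply: contraTT mxC => xC; rewrite mN.
by apply: contraTT xC => mxC; rewrite -[x]mm mN.
Qed.

(** As [Q] is stable under both involutions, one may follow [m1] inside [Q] and [m2] outside. On an
    alternating path this swaps two matchings. *)
Lemma matchable_glue (m1 m2 : {ffun T -> T}) (C1 C2 Q : {set T}) :
  is_matching m1 C1 -> is_matching m2 C2 ->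
  {in Q, forall x, m1 x \in Q} -> {in Q, forall x, m2 x \in Q} ->
  matchable ((C1 :&: Q) :|: (C2 :\: Q)).
Proof.
case/is_matchingP => mm1 mC1 mN1 /is_matchingP[mm2 mC2 mN2] Q1 Q2.
pose m := [ffun x => if x \in Q then m1 x else m2 x].
have mE x : m x = if x \in Q then m1 x else m2 x by rewrite ffunE.
apply/existsP; exists m; apply/is_matchingP; split=> [x|x|x].
- rewrite [m x]mE; case: (boolP (x \in Q)) => xQ; rewrite mE; first by rewrite Q1.
  by case: ifP => [/Q2|//]; rewrite mm2 (negPf xQ).
- by rewrite !inE mE; case: (x \in Q); rewrite ?andbT ?andbF ?orbF /=; [apply: mC1 | apply: mC2].
- by rewrite !inE mE; case: (x \in Q); rewrite ?andbT ?andbF ?orbF /=; [apply: mN1 | apply: mN2].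
Qed.

Lemma matchableU2 (C : {set T}) x y :
  matchable C -> x \notin C -> y \notin C -> e x y ->
  matchable ([set x; y] :|: C).
Proof.
case/existsP=> m mC xC yC exy.
have mxy : is_matching [ffun z => tperm x y z] [set x; y].
  apply/is_matchingP; split=> [z|z|z]; rewrite !ffunE.
  - exact: tpermK.
  - by rewrite !inE => /orP[] /eqP->; rewrite ?tpermL ?tpermR // e_sym.
  - by rewrite !inE negb_or => /andP[zx zy]; rewrite tpermD // eq_sym.
have [_ _ mN] := is_matchingP _ _ mC.
have -> : [set x; y] :|: C = ([set x; y] :&: [set x; y]) :|: (C :\: [set x; y]).
  by apply/setP=> z; rewrite !inE; case: eqP; case: eqP.
apply: (matchable_glue mxy mC) => z; rewrite !inE ?ffunE.
  by case/orP=> /eqP->; rewrite ?tpermL ?tpermR eqxx ?orbT.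
by case/orP=> /eqP->; rewrite mN ?eqxx ?orbT.
Qed.

(* The component of [v] in the union of two matchings is the orbit of [v] under
   the composite of the two involutions; as [s] fixes [v], the involution [t]
   has at most one fixed point on this orbit. *)
Lemma involution_orbit (s t : {perm T}) (v : T) :
  involutive s -> involutive t -> s v = v ->
  exists Q : {set T}, [/\ v \in Q, {in Q, forall x, s x \in Q},
    {in Q, forall x, t x \in Q}
    & {in Q &, forall x y, t x = x -> t y = y -> x = y}].
Proof.
move=> ss tt sv; pose p : {perm T} := (t * s)%g.
have pE x : p x = s (t x) by rewrite permM.
(* Conjugation by [s] inverts [p], and [s] fixes [v]. *)
have sp i : s ((p ^+ i)%g v) = (p ^- i)%g v.
  elim: i => [|i IH]; first by rewrite expg0 invg1 perm1.
  apply: (@perm_inj _ (p ^+ i.+1)%g); rewrite permKV.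
  have -> : (p ^+ i.+1)%g v = s (t ((p ^+ i)%g v)) by rewrite expgSr permM pE.
  by rewrite ss expgS permM pE tt IH permKV.
have tp i : t ((p ^+ i)%g v) = (p ^- i.+1)%g v.
  by rewrite -sp expgSr permM pE ss.
have pV i : (p ^- i)%g v \in porbit p v by rewrite -porbitV -expgVn mem_porbit.
have nofix q : (0 < q)%N -> (q < #|porbit p v|)%N -> iter q p v <> v.
  move=> q0 ltq fixq; have := uniq_traject_porbit p v => /(nth_uniq v).
  rewrite size_traject => /(_ 0%N q); rewrite !nth_traject //=; try lia.
  by rewrite fixq eqxx => /(_ _ ltq) H; have := H _; lia.
(* Here [p ^ (2 i + 1)] fixes [v] and [2 i + 1] is less than twice the orbit length, so it equals
   that length, which determines [i]. *)
have fixt i : (i < #|porbit p v|)%N -> t (iter i p v) = iter i p v ->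
    i.*2.+1 = #|porbit p v|.
  move=> lti; rewrite -permX tp => /(congr1 (p ^+ i.+1)%g); rewrite permKV -permM -expgD.
  rewrite permX => /esym fixv.
  have [ltL|gtL|<-] := ltngtP (i + i.+1) #|porbit p v|; last by lia.
    by have := nofix _ _ ltL fixv; lia.
  case: (nofix (i + i.+1 - #|porbit p v|)); [lia | lia |].
  by rewrite -[v in iter _ _ v](iter_porbit p) -iterD subnK // ltnW.
exists (porbit p v); split.
- exact: porbit_id.
- by move=> x /porbitP[i ->]; rewrite sp.
- by move=> x /porbitP[i ->]; rewrite tp.
move=> x y; rewrite !porbit_traject => /trajectP[i li ->] /trajectP[j lj ->].
by move=> /(fixt _ li) Ei /(fixt _ lj) Ej; have -> : i = j by lia.
Qed.

(** Swap the matchings along the component [Q] of [v] in their union. Maximality of [C1] forces [C2]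
    to miss some [z] in [Q], and only one such vertex exists; counting then shows that [C1] misses
    only [v] in [Q]. *)
Lemma matchable_exchange (C1 C2 : {set T}) v :
  matchable C1 -> matchable C2 -> (forall C, matchable C -> #|C| <= #|C1|) ->
  v \in C2 -> v \notin C1 ->
  exists z, [/\ z \in C1, z \notin C2, matchable (z |: (C2 :\ v))
              & matchable (v |: (C1 :\ z))].
Proof.
case/existsP=> m1 M1 /existsP[m2 M2] maxC1 vC2 vC1.
have [mm1 _ mN1] := is_matchingP _ _ M1; have [mm2 _ mN2] := is_matchingP _ _ M2.
have [Q [vQ Q1 Q2 Q2u]] : exists Q : {set T}, [/\ v \in Q,
    {in Q, forall x, m1 x \in Q}, {in Q, forall x, m2 x \in Q}
    & {in Q &, forall x y, m2 x = x -> m2 y = y -> x = y}].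
  have [||| Q [vQ Q1 Q2 Q2u]] :=
      @involution_orbit (perm (inv_inj mm1)) (perm (inv_inj mm2)) v.
  - by move=> x; rewrite !permE.
  - by move=> x; rewrite !permE.
  - by rewrite permE mN1.
  exists Q; split=> // [x /Q1|x /Q2|x y xQ yQ mx my]; rewrite ?permE //.
  by apply: Q2u; rewrite ?permE.
have swap1 := matchable_glue M2 M1 Q2 Q1; have swap2 := matchable_glue M1 M2 Q1 Q2.
have leQ : #|C2 :&: Q| <= #|C1 :&: Q|.
  have := maxC1 _ swap1; rewrite cardsU -(cardsID Q C1).
  have -> : C2 :&: Q :&: (C1 :\: Q) = set0.
    by apply/setP=> x; rewrite !inE; case: (x \in Q); rewrite ?andbF.
  by rewrite cards0; clear; lia.
have sub1 : C1 :&: Q \subset Q :\ v.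
  by apply/subsetP=> x; rewrite !inE => /andP[xC1 ->]; rewrite andbT; apply: contraNneq vC1 => <-.
have cQ := cardsD1 v Q; rewrite vQ in cQ.
have [z zQ zC2] : exists2 z, z \in Q & z \notin C2.
  apply/exists_inP; apply: contraTT leQ; rewrite negb_exists_in => /forall_inP H.
  rewrite (setIidPr _); last by apply/subsetP=> x /H; rewrite negbK.
  by move: cQ (subset_leq_card sub1); clear; lia.
have memQ x : x \in Q -> (x \in C2) = (x != z).
  move=> xQ; apply/idP/idP => [xC2|]; first by apply: contraNneq zC2 => <-.
  by apply: contraNT => xC2; apply/eqP/Q2u => //; apply: mN2.
have C2Q : C2 :&: Q = Q :\ z.
  apply/setP=> x; rewrite !inE; case: (boolP (x \in Q)) => [/memQ->|]; last by rewrite !andbF.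
  by rewrite !andbT.
have cQz := cardsD1 z Q; rewrite zQ in cQz.
have C1Q : C1 :&: Q = Q :\ v.
  apply/eqP; rewrite eqEcard sub1; rewrite C2Q in leQ.
  by move: leQ cQ cQz; clear; lia.
have nzv : z != v by apply: contraNneq zC2 => ->.
exists z; split=> //.
- have : z \in C1 :&: Q by rewrite C1Q !inE nzv zQ.
  by rewrite inE => /andP[].
- congr (is_true (matchable _)): swap2; rewrite C1Q; apply/setP=> x; rewrite !inE.
  case: (boolP (x \in Q)) => xQ; rewrite ?andbT ?andbF /= ?orbF.
    by rewrite memQ //; case: (eqVneq x z) => [->|] //=; rewrite ?nzv // andbT.
  have -> : (x == z) = false by apply: contraNF xQ => /eqP->.
  by have -> : (x == v) = false by apply: contraNF xQ => /eqP->.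
- congr (is_true (matchable _)): swap1; rewrite C2Q; apply/setP=> x; rewrite !inE.
  case: (boolP (x \in Q)) => xQ; rewrite ?andbT ?andbF /= ?orbF.
    have := C1Q => /setP/(_ x); rewrite !inE xQ !andbT => ->.
    by case: (eqVneq x v) => [->|] //=; rewrite ?andbT // eq_sym.
  have -> : (x == z) = false by apply: contraNF xQ => /eqP->.
  by have -> : (x == v) = false by apply: contraNF xQ => /eqP->.
Qed.

Lemma card_swap (C : {set T}) x y :
  x \in C -> y \notin C -> #|y |: (C :\ x)| = #|C|.
Proof. by move=> xC yC; rewrite cardsU1 (cardsD1 x C) xC !inE (negPf yC) andbF. Qed.

Lemma matchable_add_edge (C : {set T}) x y :
  matchable C -> x \notin C -> y \notin C -> e x y ->
  exists2 C', matchable C' & #|C'| = #|C| + (x != y).+1.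
Proof.
move=> mC xC yC exy; exists ([set x; y] :|: C); first exact: matchableU2.
rewrite cardsU cards2 (_ : _ :&: C = set0) ?cards0; first by lia.
by apply/setP=> z; rewrite !inE; apply/negP => /andP[/orP[] /eqP-> ]; apply/negP.
Qed.

(* If no vertex is essential, then [p |-> p :&: C] maps the edges injectively
   to the nonempty subsets of size at most 2 of a maximum matchable set [C]:
   an endpoint [x] in [C] of an edge that leaves [C] carries no loop, and no
   second edge leaving [C]. *)
Lemma card_edges_no_essential (C : {set T}) :
  matchable C -> (forall C', matchable C' -> #|C'| <= #|C|) ->
  (forall v, exists C', [/\ matchable C', v \notin C' & #|C| <= #|C'|.+1]) ->
  #|edges| <= 'C(#|C|.+1, 2).
Proof.
move=> mC maxC ness.
(* The set missing [x] given by [ness] contains [y], since otherwise the edge would enlarge it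
   beyond [#|C|]. Exchange [y] with some [z] in [C]: if [z] is not [x], both endpoints become free
   and the same contradiction arises. *)
have missable x y : x \in C -> y \notin C -> e x y ->
    exists C', [/\ matchable C', x \notin C' & #|C'| = #|C|].
  move=> xC yC exy; have [C' [mC' xC' leC']] := ness x.
  have nxy : x != y by apply: contraTneq xC => ->.
  have contra D : matchable D -> #|D| = #|C'| -> x \notin D -> y \notin D -> False.
    move=> mD cD xD yD; have [D' /maxC] := matchable_add_edge mD xD yD exy.
    by rewrite nxy => /[swap] ->; rewrite cD; move: leC'; clear; lia.
  have [yC'|yC'] := boolP (y \in C'); last by case: (contra C').
  have [z [zC zC' mz1 mz2]] := matchable_exchange mC mC' maxC yC' yC.
  have [zx|nzx] := eqVneq z x.
    exists (y |: (C :\ z)); split=> //; first by rewrite zx !inE eqxx orbF.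
    exact: card_swap.
  case: (contra _ mz1).
  - exact: card_swap.
  - by rewrite !inE negb_or eq_sym nzx negb_and xC' orbT.
  - by rewrite !inE negb_or eqxx andbT; apply: contraTneq zC => <-.
have noloop x y : x \in C -> y \notin C -> e x y -> e x x = false.
  move=> xC yC exy; apply/negP => exx; have [C' [mC' xC' cC']] := missable _ _ xC yC exy.
  have [D /maxC] := matchable_add_edge mC' xC' xC' exx.
  by rewrite eqxx => /[swap] ->; rewrite cC' addn1 ltnn.
have uniq_nbr x y y' : x \in C -> y \notin C -> y' \notin C -> e x y -> e x y' -> y = y'.
  move=> xC yC yC' exy exy'; apply/eqP; apply: contraT => nyy'.
  have [C' [mC' xC' cC']] := missable _ _ xC yC exy.
  have maxC' D : matchable D -> #|D| <= #|C'| by rewrite cC'; apply: maxC.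
  (* Trading [x] for [z] in [C] leaves [x] and at least one of [y], [y'] uncovered, and these can be
     matched. *)
  have [z [_ zC mz _]] := matchable_exchange mC' mC maxC' xC xC'.
  have [t [tC ext nzt]] : exists t, [/\ t \notin C, e x t & z != t].
    have [zy|nzy] := eqVneq z y; first by exists y'; split; rewrite ?zy.
    by exists y; split.
  have nxt : x != t by apply: contraTneq xC => ->.
  have [||D /maxC] := matchable_add_edge mz _ _ ext.
  - by rewrite !inE eqxx orbF; apply: contraTneq xC => ->.
  - by rewrite !inE negb_or eq_sym nzt negb_and tC orbT.
  by rewrite nxt card_swap // => /[swap] ->; rewrite addn2 ltnNge leqnSn.
have edgeP p : p \in edges -> (exists x y, p = [set x; y] /\ e x y) /\
    (p \subset C \/ exists x y, [/\ p = [set x; y], e x y, x \in C & y \notin C]).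
  rewrite inE => /existsP[x /existsP[y /andP[/eqP-> exy]]]; split; first by exists x, y.
  have [xC|xC] := boolP (x \in C); have [yC|yC] := boolP (y \in C).
  - by left; rewrite subUset !sub1set xC.
  - by right; exists x, y.
  - by right; exists y, x; rewrite setUC e_sym.
  - have [D /maxC] := matchable_add_edge mC xC yC exy => /[swap] ->.
    by rewrite addnS ltnNge leq_addr.
have capE x y : x \in C -> y \notin C -> [set x; y] :&: C = [set x].
  move=> xC yC; apply/setP=> z; rewrite !inE; case: (eqVneq z x) => [->|_] /=; first by rewrite xC.
  by case: eqVneq => //= ->; apply/negbTE.
have loopP x : [set x] \in edges -> e x x.
  rewrite inE => /existsP[a /existsP[b /andP[/eqP E eab]]].
  have: a \in [set x] by rewrite E !inE eqxx.
  have: b \in [set x] by rewrite E !inE eqxx orbT.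
  by rewrite !inE => /eqP bx /eqP ax; rewrite ax bx in eab.
have capI : {in edges &, injective (fun p => p :&: C)}.
  (* With equal traces on [C], the edge inside [C] would be a loop at the endpoint of the edge
     leaving [C]. *)
  have mixed p q : p \in edges -> p \subset C ->
      (exists x y, [/\ q = [set x; y], e x y, x \in C & y \notin C]) -> p :&: C <> q :&: C.
    move=> pE /setIidPl-> [x [y [-> exy xC yC]]]; rewrite capE // => E.
    by move: pE; rewrite E => /loopP; rewrite (noloop x y).
  move=> p q pE qE /=; have [_ [pC|pN]] := edgeP p pE; have [_ [qC|qN]] := edgeP q qE.
  - by rewrite (setIidPl pC) (setIidPl qC).
  - by move/(mixed _ _ pE pC qN).
  - by move/esym/(mixed _ _ qE qC pN).
  - case: pN qN => [x [y [-> exy xC yC]]] [x' [y' [-> exy' xC' yC']]].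
    rewrite !capE // => /setP/(_ x); rewrite !inE eqxx => /esym/eqP xx; subst x'.
    by rewrite (uniq_nbr x y y').
pose draws i := [set S : {set T} | S \subset C & #|S| == i].
(* Pascal's rule splits the bound into the counts of 2-subsets and 1-subsets of [C]. *)
rewrite -(card_in_imset capI) binS bin1 -(cards_draws C 2).
rewrite -[X in _ <= _ + X]bin1 -(cards_draws C 1).
apply: leq_trans (leq_card_setU (draws 2) (draws 1)).
apply/subset_leq_card/subsetP=> _ /imsetP[p pE ->]; rewrite !inE subsetIr /=.
have [[x [y [Ep exy]]] pC] := edgeP p pE.
have le2 : #|p :&: C| <= 2.
  by apply: leq_trans (subset_leq_card (subsetIl _ _)) _; rewrite Ep cards2; case: eqP.
suff: 0 < #|p :&: C| by move: le2; clear; lia.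
case: pC => [/setIidPl->|[a [b [-> _ aC bC]]]]; last by rewrite capE // cards1.
by rewrite Ep cards2; case: eqP.
Qed.

End Matchings.

(** The set [W] records the vertices not yet deleted, so that [T] stays fixed in the induction; [a]
    counts the deletions. *)
Lemma card_edges_matching (k : nat) (T : finType) (e : rel T) (W : {set T}) :
  symmetric e -> (forall x y, e x y -> x \in W) ->
  (forall C, matchable e C -> #|C| <= k) ->
  exists a, 2 * a <= k /\ #|edges e| + 'C(a, 2) <= a * #|W| + 'C(k.+1 - 2 * a, 2).
Proof.
elim/ltn_ind: k => k IH in e W *; move=> e_sym eW lek.
case: (arg_maxnP (fun C : {set T} => #|C|) (matchable0 e)) => C mC maxC.
have leCk := lek _ mC.
have [/existsP[v /forall_inP ess]|] :=
    boolP [exists v, [forall (D | matchable e D && (v \notin D)), #|D|.+2 <= #|C|]].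
  have C2 : 2 <= #|C| by have := ess set0; rewrite matchable0 inE cards0; apply.
  pose e' := [rel x y | [&& e x y, x != v & y != v]].
  have vW : v \in W.
    (* A vertex outside [C] could be deleted without lowering the maximum. *)
    have: v \in C by apply: contraT => vC; have := ess C; rewrite mC vC => /(_ isT); lia.
    by case/existsP: mC => m /is_matchingP[_ mC _] /mC/eW.
  have [||| |a [a2 aP]] := IH (k - 2) _ e' (W :\ v).
  - by lia.
  - by move=> x y /=; rewrite e_sym andbA andbAC -andbA.
  - by move=> x y /and3P[/eW xW xv _]; rewrite !inE xv.
  - move=> D /existsP[m /is_matchingP[mm mD mN]].
    suff : #|D|.+2 <= #|C| by lia.
    apply: ess; apply/andP; split.
      apply/existsP; exists m; apply/is_matchingP; split=> // x /mD.
      by case/and3P.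
    by apply/negP => /mD /and3P[_]; rewrite eqxx.
  exists a.+1; split; first by lia.
  have leE : #|edges e| <= #|edges e'| + #|W|.
    apply: leq_trans (_ : #|edges e' :|: [set [set v; x] | x in W]| <= _).
      apply/subset_leq_card/subsetP=> p; rewrite !inE.
      case/existsP=> x /existsP[y /andP[/eqP-> exy]].
      have [->|xv] := eqVneq x v.
        by apply/orP; right; apply/imsetP; exists y => //; apply: (eW y x); rewrite e_sym.
      have [->|yv] := eqVneq y v.
        by apply/orP; right; apply/imsetP; exists x; rewrite 1?setUC //; apply: eW exy.
      by apply/orP; left; apply/existsP; exists x; apply/existsP; exists y; rewrite eqxx /= exy xv.
    by apply: leq_trans (leq_card_setU _ _) _; rewrite leq_add2l leq_imset_card.
  have cW := cardsD1 v W; rewrite vW in cW.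
  have -> : k.+1 - 2 * a.+1 = (k - 2).+1 - 2 * a by lia.
  (* The increase [a] from ['C(a, 2)] to ['C(a.+1, 2)] is paid for by [W :\ v] having one vertex
     less. *)
  by rewrite binS bin1; nia.
rewrite negb_exists => /forallP noess.
exists 0; split=> //; rewrite bin0n addn0 mul0n add0n muln0 subn0.
apply: leq_trans (leq_bin2l _ (_ : #|C|.+1 <= k.+1)) => //.
apply: card_edges_no_essential => // v.
have := noess v; rewrite negb_forall_in => /exists_inP[D /andP[mD vD] leD].
by exists D; split=> //; lia.
Qed.

(** * Nonvanishing of a determinant through a top coefficient *)

Local Open Scope ring_scope.

(** These are the weights of the divided difference of order [d] on the first [d + 1] points. *)
Lemma top_coefficient_functional (F : fieldType) (pt : 'I_3 -> F) (d : nat) :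
  injective pt -> (d <= 2)%N ->
  exists om : 'I_3 -> F,
    (forall m, (m < d)%N -> \sum_j om j * pt j ^+ m = 0) /\
    \sum_j om j * pt j ^+ d = 1.
Proof.
move=> pt_inj le_d2.
set a := pt ord0; set b := pt (lift ord0 ord0).
set c := pt (lift ord0 (lift ord0 ord0)).
have ab : a - b != 0 by rewrite subr_eq0 (inj_eq pt_inj).
have ac : a - c != 0 by rewrite subr_eq0 (inj_eq pt_inj).
have bc : b - c != 0 by rewrite subr_eq0 (inj_eq pt_inj).
pose om u v w (j : 'I_3) : F := nth 0 [:: u; v; w] j.
have omE u v w m : \sum_j om u v w j * pt j ^+ m = u * a ^+ m + v * b ^+ m + w * c ^+ m.
  by rewrite !big_ord_recl big_ord0 addr0 addrA.
case: d le_d2 => [|[|[|//]]] _.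
- exists (om 1 0 0); split=> [//|]; rewrite omE; ring.
- exists (om (a - b)^-1 (- (a - b)^-1) 0); split=> [[|//] _|]; rewrite omE; first by ring.
  by field.
- exists (om (((a - b) * (a - c))^-1) (- ((a - b) * (b - c))^-1)
         (((a - c) * (b - c))^-1)).
  split=> [[|[|//]] _|]; rewrite omE ?expr0 ?expr1; field; exact/and3P.
Qed.

Lemma big_option (R : Type) (idx : R) (op : Monoid.com_law idx) (T : finType)
    (f : option T -> R) :
  \big[op/idx]_o f o = op (f None) (\big[op/idx]_x f (Some x)).
Proof.
rewrite (bigD1 None) //= (reindex_omap (Some : T -> option T) id) => [|[]//].
by congr (op _ _); apply: eq_bigl => x; rewrite eqxx.
Qed.

(** Multilinearity in the rows: [st.2] chooses the summand that supplies each row. *)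
Lemma det_sum_expand (F : fieldType) (n : nat) (J : finType) (c : J -> F)
    (Y : J -> 'M[F]_n) :
  \det (\sum_o c o *: Y o) =
  \sum_(st : 'S_n * {ffun 'I_n -> J})
    (-1) ^+ st.1 * \prod_i Y (st.2 i) i (st.1 i) * \prod_i c (st.2 i).
Proof.
rewrite /determinant -(pair_bigA _ (fun (t : 'S_n) (u : {ffun 'I_n -> J}) =>
  (-1) ^+ t * \prod_i Y (u i) i (t i) * \prod_i c (u i))) /=.
apply: eq_bigr => t _.
under eq_bigr => i _ do rewrite summxE.
rewrite bigA_distr_bigA big_distrr /=; apply: eq_bigr => u _.
rewrite -mulrA -big_split; congr (_ * _); apply: eq_bigr => i _.
by rewrite mxE mulrC.
Qed.

(* The weights force the only term of the Leibniz expansion of the determinant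
   that contributes to [\prod_l x_l ^+ #|[set i | r i == l]|]: along any such
   term all the inequalities [leX] add up to an equality. *)
Lemma exists_det_neq0 (F : fieldType) (pt : 'I_3 -> F) (n : nat) (L : finType)
    (r : 'I_n -> L) (phi : 'I_n -> 'I_n) (w : 'I_n -> nat) (g : L -> nat)
    (A : 'M[F]_n) (X : L -> 'M[F]_n) :
  injective pt -> injective phi ->
  (forall l, (#|[set i | r i == l]| <= 2)%N) ->
  (forall i, g (r i) = (w i + w (phi i))%N) ->
  (forall k i j, X (r k) i j != 0 -> (w i + w j <= g (r k))%N) ->
  (forall k i j, X (r k) i j != 0 -> (w i + w j)%N = g (r k) ->
     r i = r k /\ j = phi i) ->
  (forall i, X (r i) i (phi i) != 0) ->
  exists x : L -> F, \det (A + \sum_l x l *: X l) != 0.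
Proof.
move=> pt_inj phi_inj le2 gE leX eqX X0.
pose dg l := #|[set i | r i == l]|.
have [om omP] := fin_all_exists (fun l => top_coefficient_functional pt_inj (le2 l)).
(* [None] is the constant summand [A], with coefficient 1. *)
pose Y (o : option L) := if o is Some l then X l else A.
pose c (x : {ffun L -> 'I_3}) (o : option L) : F := if o is Some l then pt (x l) else 1.
have sumE (x : {ffun L -> 'I_3}) : A + \sum_l pt (x l) *: X l = \sum_o c x o *: Y o.
  by rewrite big_option /= scale1r.
case: (boolP [exists x : {ffun L -> 'I_3}, \det (\sum_o c x o *: Y o) != 0]) => [/existsP[x det0]|].
  by exists (fun l => pt (x l)); rewrite sumE.
rewrite negb_exists => /forallP alldet0; exfalso.
(* [cnt u l] is the exponent of [x_l] in the monomial chosen by [u], and [K u] applies the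
   functional [om l] in each variable to that monomial. *)
pose cnt (u : {ffun 'I_n -> option L}) l := #|[set i | u i == Some l]|.
pose K u := \prod_l \sum_j om l j * pt j ^+ cnt u l.
have KE (u : {ffun 'I_n -> option L}) :
    \sum_(x : {ffun L -> 'I_3}) (\prod_l om l (x l)) * \prod_i c x (u i) = K u.
  rewrite /K bigA_distr_bigA; apply: eq_bigr => x _; rewrite big_split; congr (_ * _).
  rewrite (partition_big u xpredT) //= big_option /= big1 ?mul1r => [|i /eqP-> //].
  apply: eq_bigr => l _; rewrite /cnt cardsE -prodr_const.
  by apply: eq_big => [i|i /eqP->].
have : \sum_(x : {ffun L -> 'I_3}) (\prod_l om l (x l)) * \det (\sum_o c x o *: Y o) = 0.
  by apply: big1 => x _; have:= alldet0 x; rewrite negbK => /eqP->; rewrite mulr0.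
under eq_bigr => x _ do rewrite det_sum_expand big_distrr /=.
rewrite exchange_big /=.
under eq_bigr => st _.
  under eq_bigr => x _ do rewrite mulrCA.
  rewrite -big_distrr /= KE; over.
pose st0 := (perm phi_inj, [ffun i => Some (r i)] : {ffun 'I_n -> option L}).
have cnt0 l : cnt st0.2 l = dg l.
  by apply: eq_card => i; rewrite !inE ffunE (inj_eq Some_inj).
rewrite (bigD1 st0) //= [X in _ + X]big1 ?addr0; last first.
  move=> [t u] /= ne_st0; apply/eqP; apply: contraNT ne_st0.
  rewrite mulf_eq0 negb_or mulf_eq0 signr_eq0 /= => /andP[prodY0 K0].
  have Y0 i : Y (u i) i (t i) != 0.
    by move/prodf_neq0: prodY0; apply.
  (* Smaller exponents are killed by [om l]. As the [dg l] already add up to [n], all exponents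
     agree and no row comes from [A]. *)
  have le_dg l : (dg l <= cnt u l)%N.
    rewrite leqNgt; apply/negP => /(omP l).1 z.
    by case/negP: K0; rewrite /K (bigD1 l) //= z mul0r.
  have sum_dg : (\sum_l dg l = n)%N.
    rewrite -[RHS]card_ord -[RHS]sum1_card [RHS](partition_big r xpredT) //=.
    by apply: eq_bigr => l _; rewrite sum1_card; apply: eq_card => i; rewrite !inE.
  have sum_cnt : (#|[set i | u i == None]| + \sum_l cnt u l = n)%N.
    rewrite -[RHS]card_ord -[RHS]sum1_card [RHS](partition_big u xpredT) //= big_option /=.
    congr (_ + _)%N; first by rewrite sum1_card; apply: eq_card => i; rewrite !inE.
    by apply: eq_bigr => l _; rewrite sum1_card; apply: eq_card => i; rewrite !inE.
  have sum_le : (\sum_l dg l <= \sum_l cnt u l)%N by apply: leq_sum => l _.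
  have dgE l : dg l = cnt u l.
    have: (\sum_l dg l == \sum_l cnt u l)%N by lia.
    have := leqif_sum (fun l (_ : xpredT l) => leqif_eq (le_dg l)) => -[_ ->].
    by move/forallP/(_ l)/eqP.
  have noneE : #|[set i | u i == None]| = 0%N by lia.
  have uP i : exists k, u i = Some (r k).
    case ui: (u i) => [l|]; last first.
      by move/eqP: noneE; rewrite cards_eq0 => /eqP/setP/(_ i); rewrite !inE ui eqxx.
    have: (0 < dg l)%N by rewrite dgE; apply/card_gt0P; exists i; rewrite inE ui.
    by case/card_gt0P => k; rewrite inE => /eqP <-; exists k.
  have [k kP] := fin_all_exists uP.
  have XkY i : X (r (k i)) i (t i) != 0 by have := Y0 i; rewrite kP.
  (* Both totals are twice the sum of [w], because [t] and [phi] permute the indices. *)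
  have sum_g : (\sum_i (w i + w (t i)) = \sum_i g (r (k i)))%N.
    have -> : (\sum_i g (r (k i)) = \sum_l dg l * g l)%N.
      rewrite (partition_big (fun i => r (k i)) xpredT) //=.
      apply: eq_bigr => l _; rewrite dgE /cnt -sum_nat_const.
      by apply: eq_big => [i|i /eqP->//]; rewrite inE kP (inj_eq Some_inj).
    have -> : (\sum_l dg l * g l = \sum_i g (r i))%N.
      rewrite [RHS](partition_big r xpredT) //=.
      apply: eq_bigr => l _; rewrite -sum_nat_const.
      by apply: eq_big => [i|i]; rewrite inE // => /eqP->.
    under [RHS]eq_bigr do rewrite gE.
    rewrite !big_split /=; congr addn.
    rewrite -(reindex_inj (@perm_inj _ t) (P := xpredT) (F := w)).
    by rewrite -(reindex_inj phi_inj (P := xpredT) (F := w)).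
  have eqg i : (w i + w (t i))%N = g (r (k i)).
    have := leqif_sum (fun i (_ : xpredT i) => leqif_eq (leX _ _ _ (XkY i))).
    by case=> _; rewrite sum_g eqxx => /esym/forallP/(_ i)/eqP.
  apply/eqP; congr pair.
    by apply/permP => i; rewrite permE; case: (eqX _ _ _ (XkY i) (eqg i)).
  by apply/ffunP => i; rewrite ffunE kP; case: (eqX _ _ _ (XkY i) (eqg i)) => ->.
move/eqP; apply/negP; rewrite !mulf_neq0 ?signr_eq0 //.
  by apply/prodf_neq0 => i _; rewrite ffunE permE; exact: X0.
by apply/prodf_neq0 => l _; rewrite cnt0 (omP l).2 oner_eq0.
Qed.

(** * Leading positions and the rank they force *)

Lemma addn_exp3_inj (a b c d : nat) :
  (3 ^ a + 3 ^ b = 3 ^ c + 3 ^ d)%N -> (a = c /\ b = d) \/ (a = d /\ b = c).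
Proof.
have main x y z t : (x <= y)%N -> (z <= t)%N -> (3 ^ x + 3 ^ y = 3 ^ z + 3 ^ t)%N ->
    x = z /\ y = t.
  move=> xy zt E.
  (* In base 3 the larger exponent dominates, so the sum determines it first. *)
  have lt p q r : (p <= q)%N -> (q < r)%N -> (3 ^ p + 3 ^ q < 3 ^ r)%N.
    move=> pq qr; have := leq_pexp2l (isT : (0 < 3)%N) pq.
    have := leq_pexp2l (isT : (0 < 3)%N) qr; rewrite expnS.
    by have := expn_gt0 3 q; lia.
  have yt : y = t.
    case: (ltngtP y t) => // [/(lt _ _ _ xy)|/(lt _ _ _ zt)]; lia.
  split=> //; apply: (@expnI 3) => //; subst; lia.
move=> E; case: (leqP a b) => ab; case: (leqP c d) => cd.
- by left; exact: main ab cd E.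
- by right; apply: (main _ _ _ _ ab (ltnW cd)); rewrite [RHS]addnC.
- by right; case: (main _ _ _ _ (ltnW ab) cd); rewrite 1?[LHS]addnC.
- left; case: (main _ _ _ _ (ltnW ab) (ltnW cd)) => [|-> ->//].
  by rewrite addnC E addnC.
Qed.

Lemma set2_eq (T : finType) (a b c d : T) :
  [set a; b] = [set c; d] -> (a = c /\ b = d) \/ (a = d /\ b = c).
Proof.
move=> E; have /set2P ac : a \in [set c; d] by rewrite -E set21.
have /set2P bc : b \in [set c; d] by rewrite -E set22.
have /set2P ca : c \in [set a; b] by rewrite E set21.
have /set2P da : d \in [set a; b] by rewrite E set22.
by case: ac bc ca da => -> [] -> [] ? [] ?; subst; auto.
Qed.

(* The weights [3 ^ i + 3 ^ j] order the positions [{i, j}] linearly. *)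
Definition is_lead (F : fieldType) (n : nat) (X : 'M[F]_n) (p : {set 'I_n}) : Prop :=
  exists i j, [/\ p = [set i; j], X i j != 0
    & forall i' j', X i' j' != 0 -> (3 ^ i' + 3 ^ j' <= 3 ^ i + 3 ^ j)%N].

(** The set forgets the order of the two indices; weak symmetry makes both entries nonzero. *)
Lemma is_lead_pair (F : fieldType) (n : nat) (X : 'M[F]_n) (i j : 'I_n) :
  weakly_symmetric X -> is_lead X [set i; j] ->
  X i j != 0 /\ forall i' j', X i' j' != 0 -> (3 ^ i' + 3 ^ j' <= 3 ^ i + 3 ^ j)%N.
Proof.
move=> wX [a [b [/set2_eq[] [-> ->] Xab le]]]; split=> //; first exact/wX.
by move=> i' j' /le; rewrite [in X in (_ <= X)%N]addnC.
Qed.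

(** The codomain [F^o] is the field as a vector space over itself, so that [linfun] applies. *)
Definition mx_entry (F : fieldType) (n : nat) (i j : 'I_n) (Y : 'M[F]_n) : F^o := Y i j.

Fact mx_entry_is_linear (F : fieldType) (n : nat) (i j : 'I_n) :
  linear (@mx_entry F n i j).
Proof. by move=> a Y Z; rewrite /mx_entry !mxE. Qed.

HB.instance Definition _ (F : fieldType) (n : nat) (i j : 'I_n) :=
  GRing.isLinear.Build F 'M[F]_n F^o _ (@mx_entry F n i j) (mx_entry_is_linear i j).

(** Echelon argument: take a leading position of one member and pass to the members vanishing there.
    This costs at most one dimension, and by weak symmetry none of them leads at that position
    again. *)
Lemma card_leads (F : fieldType) (n : nat) (B : {vspace 'M[F]_n}) :
  (forall X, X \in B -> weakly_symmetric X) ->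
  exists2 P : {set {set 'I_n}}, (\dim B <= #|P|)%N
    & forall p, p \in P -> exists2 X, X \in B & is_lead X p.
Proof.
move: (leqnn (\dim B)); move: {1 3}(\dim B) => d.
elim: d => [|d IH] in B *; first by exists set0 => // p; rewrite inE.
move=> led wB.
have B0 : B != 0%VS by rewrite -dimv_eq0; lia.
have /matrix0Pn[i0 [j0 X0]] : vpick B != 0 by rewrite vpick0.
case: (arg_maxnP (fun q : 'I_n * 'I_n => 3 ^ q.1 + 3 ^ q.2)%N
  (X0 : [pred q | vpick B q.1 q.2 != 0] (i0, j0))) => -[i j] /= Xij maxij.
pose f := linfun (@mx_entry F n i j).
have dimB : (d <= \dim (B :&: lker f))%N.
  have := limg_ker_dim f B; have := dimvS (subvf (f @: B)%VS); rewrite dimvf.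
  rewrite (_ : dim _ = 1%N) // => le1 dimE; rewrite -ltnS; apply: leq_trans led _.
  by rewrite -[X in (X <= _)%N]dimE -addn1 leq_add2l.
have [X|P leP PP] := IH _ dimB; first by rewrite memv_cap => /andP[/wB].
exists ([set i; j] |: P).
  rewrite cardsU1 (_ : [set i; j] \notin P) ?add1n //; apply/negP => /PP[Y].
  rewrite memv_cap memv_ker => /andP[/wB wY]; rewrite lfunE /= => Y0.
  by case/(is_lead_pair wY); rewrite (eqP Y0 : Y i j = 0) eqxx.
move=> p; rewrite !inE => /orP[/eqP->|/PP[X]].
  exists (vpick B); first exact: memv_pick.
  by exists i, j; split=> // i' j' Xij'; apply: (maxij (i', j')).
by rewrite memv_cap => /andP[XB _]; exists X.
Qed.

Lemma rank_matchable_leads (F : fieldType) (pt : 'I_3 -> F) (n : nat) (A : 'M[F]_n)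
    (B : {vspace 'M[F]_n}) (P : {set {set 'I_n}}) (C : {set 'I_n}) :
  injective pt -> (forall X, X \in B -> weakly_symmetric X) ->
  (forall p, p \in P -> exists2 X, X \in B & is_lead X p) ->
  matchable [rel i j | [set i; j] \in P] C ->
  exists2 M, affine_space A B M & (#|C| <= \rank M)%N.
Proof.
move=> pt_inj wB PP /existsP[m M]; have [mm mC mN] := is_matchingP _ _ _ M.
have exX i : exists Y : 'M[F]_n, Y \in B /\ (i \in C -> is_lead Y [set i; m i]).
  have [iC|_] := boolP (i \in C); last by exists 0; rewrite mem0v.
  by have [X XB lX] := PP _ (mC _ iC); exists X.
have [X0 X0P] := fin_all_exists exX.
pose D : 'M[F]_n := diag_mx (\row_i (i \in C)%:R).
have DE Y i j : (D *m Y) i j = (i \in C)%:R * Y i j by rewrite mul_diag_mx !mxE.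
(* Instead of extracting a minor, [D] erases the rows outside [C] and diagonal units pad them, so
   that a full determinant can be used. *)
pose X l := if l \in C then D *m X0 l else delta_mx l l.
(* One representative per matched pair, so that each edge contributes a single variable. *)
pose r (i : 'I_n) := if (i <= m i)%N then i else m i.
have rm i : r (m i) = r i.
  rewrite /r mm; case: (leqP (m i) i) => h1; case: (leqP i (m i)) => h2 //.
    by apply/val_inj/eqP; rewrite eqn_leq h1 h2.
  by have := ltn_trans h1 h2; rewrite ltnn.
have rP i : r i = i \/ r i = m i by rewrite /r; case: ifP; auto.
have rr i : r (r i) = r i by case: (rP i) => E; rewrite {1}E ?rm.
have XP l : [/\ forall i j, X l i j != 0 -> (3 ^ i + 3 ^ j <= 3 ^ l + 3 ^ m l)%N,
    X l l (m l) != 0 & X l (m l) l != 0].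
  rewrite /X; case: ifP => [lC|/negbT lC].
    have [XB /(_ lC) lX] := X0P l; have [Xl le] := is_lead_pair (wB _ XB) lX.
    rewrite !DE (matching_mem _ M) lC !mul1r; split=> //; last exact/(wB _ XB).
    by move=> i j; rewrite DE mulf_eq0 negb_or => /andP[_ /le].
  rewrite mN // !mxE !eqxx oner_eq0; split=> // i j; rewrite mxE.
  by case: (eqVneq i l) => [->|]; case: (eqVneq j l) => [->|] //=; rewrite eqxx.
have [] := @exists_det_neq0 F pt n 'I_n r m (fun i => 3 ^ i)%N
    (fun l => 3 ^ l + 3 ^ m l)%N (D *m A) X pt_inj (inv_inj mm).
- move=> l; apply: leq_trans (_ : #|[set l; m l]| <= 2)%N; last by rewrite cards2; case: eqP.
  apply/subset_leq_card/subsetP => i; rewrite !inE => /eqP <-.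
  by case: (rP i) => ->; rewrite ?mm eqxx ?orbT.
- by move=> i; case: (rP i) => ->; rewrite ?mm // addnC.
- by move=> k i j; case: (XP (r k)) => H _ _; apply: H.
- move=> k i j _ /addn_exp3_inj E.
  have {E} [[/val_inj-> /val_inj->]|[/val_inj-> /val_inj->]] := E; first by rewrite rr.
  by rewrite rm rr mm.
- move=> i; case: (XP (r i)) => _ H1 H2; case: (rP i) => E; first by move: H1; rewrite E.
  by move: H2; rewrite E mm.
move=> x detx; exists (A + \sum_(l in C) x l *: X0 l).
  exists (\sum_(l in C) x l *: X0 l) => //.
  by apply: memv_suml => l lC; apply: memvZ; case: (X0P l).
move: detx; rewrite -unitfE -unitmxE => /mxrank_unit.
rewrite (bigID (mem C)) /= addrA.
have -> : D *m A + \sum_(l in C) x l *: X l = D *m (A + \sum_(l in C) x l *: X0 l).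
  rewrite mulmxDr mulmx_sumr; congr (_ + _); apply: eq_bigr => l lC.
  by rewrite /X lC scalemxAr.
set M' := A + _; set N := \sum_(l | _) _ => rk.
(* Removing the padding costs at most one unit of rank per index outside [C]. *)
have rkN : (\rank N <= #|~: C|)%N.
  rewrite /N -sum1_card [X in (_ <= X)%N](eq_bigl (fun l => l \notin C)).
    2: by move=> l; rewrite inE.
  elim/big_rec2: _ => [|l y1 y2 lC le]; first by rewrite mxrank0.
  apply: leq_trans (mxrank_add _ _) (leq_add _ le).
  by rewrite /X (negPf lC) (leq_trans (mxrank_scale _ _)) // mxrank_delta.
have := cardsC C; rewrite card_ord => cC.
have le_n := mxrank_add (D *m M') N; rewrite rk in le_n.
rewrite -(leq_add2r #|~: C|) cC; exact: leq_trans le_n (leq_add (mxrankM_maxr D M') rkN).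
Qed.

(* The bound is convex in [a], hence largest at [a = 0] or [a = k./2]. *)
Lemma u_s_convex (n k a E : nat) :
  (k <= n)%N -> (2 * a <= k)%N ->
  (E + 'C(a, 2) <= a * n + 'C(k.+1 - 2 * a, 2))%N -> (E <= u_s n k)%N.
Proof.
have bin2E p : ('C(p, 2) * 2 + p = p * p)%N.
  by elim: p => // p; rewrite binS bin1; set c := 'C(p, 2); lia.
move=> kn ak; rewrite /u_s; have := odd_double_half k.
set t := k./2 => kE; have [b tE] : exists b, t = (a + b)%N by exists (t - a)%N; lia.
have h1 := bin2E a; have h2 := bin2E t.
have tn : ('C(t, 2) <= t * n)%N.
  have : (t * t <= t * n)%N by rewrite leq_mul2l; lia.
  lia.
case: (odd k) kE => /= kE.
  have -> : (k.+1 - 2 * a = 2 * b + 2)%N by lia.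
  have h3 := bin2E (2 * b + 2)%N; have h4 := bin2E (2 * t + 2)%N.
  move=> lE; rewrite leq_max; apply/orP.
  (* Twice the bound at [0] minus twice the bound at [a] is [a * (8 * t + 5 - 2 * n - 3 * a)]; if
     this factor is negative, the bound at [t] is the larger one. For even [k] the constant 5
     becomes 1. *)
  case: (leqP (2 * n + 3 * a) (8 * t + 5)) => cmp; [left | right].
    have := leq_mul (leqnn a) cmp; rewrite tE in h4 *; lia.
  have := leq_mul (leqnn b) (ltnW cmp).
  have := leq0n (a * b); have := leq0n (b * b).
  rewrite tE in h2 tn *; lia.
have -> : (k.+1 - 2 * a = 2 * b + 1)%N by lia.
have h3 := bin2E (2 * b + 1)%N; have h4 := bin2E (2 * t + 1)%N.
move=> lE; rewrite leq_max; apply/orP.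
case: (leqP (2 * n + 3 * a) (8 * t + 1)) => cmp; [left | right].
  have := leq_mul (leqnn a) cmp; rewrite tE in h4 *; lia.
have := leq_mul (leqnn b) (ltnW cmp).
have := leq0n (a * b); have := leq0n (b * b).
rewrite tE in h2 tn *; lia.
Qed.

Theorem theorem1p5 (F : fieldType) (hF : exists s : 3.-tuple F, uniq s)
    (n : nat) (A : 'M[F]_n) (B : {vspace 'M[F]_n})
    (hB : forall X : 'M[F]_n, X \in B -> weakly_symmetric X)
    (k : nat) (hk : max_rank_eq (affine_space A B) k) :
  (\dim B <= u_s n k)%N.
Proof.
case: hF hk => s /tuple_uniqP pt_inj [[M0 _ rk0] lek].
have [P leP PP] := card_leads hB.
have kn : (k <= n)%N by rewrite -rk0 rank_leq_row.
pose e := [rel i j : 'I_n | [set i; j] \in P].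
have [||C mC|a [a2 aP]] := @card_edges_matching k 'I_n e setT.
- by move=> i j /=; rewrite setUC.
- by move=> i j _; rewrite inE.
- by have [M /lek le1 le2] := rank_matchable_leads A pt_inj hB PP mC; apply: leq_trans le2 le1.
apply: leq_trans leP _; apply: (u_s_convex kn a2).
rewrite cardsT card_ord in aP; apply: leq_trans aP; rewrite leq_add2r.
apply/subset_leq_card/subsetP => p pP; have [X _ [i [j [Ep _ _]]]] := PP p pP.
by rewrite inE; apply/existsP; exists i; apply/existsP; exists j; rewrite Ep eqxx /= -Ep.
Qed.
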